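(* (Global smoothness indicator for the one-dimensional CWENOZ5 reconstruction.) With $I_0,I_1,I_2,I_3$ the smoothness indicators defined in the context, one obtains $\theta(\hat\tau_5)=6$ with any choice $$\hat\tau_5=|\,t I_1+4t I_2+t I_3-6t I_0\,|,\qquad t\in\mathbb{R},$$ and no value of $t$ can lead to an improvement.
   Context: Notation: $\theta(g(\rho))=r$ means that $g(\rho)=a_r\rho^r+o(\rho^r)$ for $\rho\to0$ with $a_r\neq0$; here $\rho=\Delta x$. An improvement means a larger value of $\theta(\hat\tau_5)$. Let $u$ be a smooth real function of one variable near $0$, let $\Omega_i=[(i-\tfrac12)\Delta x,(i+\tfrac12)\Delta x]$ and let $\overline u_i$ be the average of $u$ on $\Omega_i$. $P_1,P_2,P_3$ are the polynomials of degree at most $2$ whose cell averages match $\overline u_i$ on $i\in\{-2,-1,0\}$, $i\in\{-1,0,1\}$ and $i\in\{0,1,2\}$ respectively; $P_{\mathrm{opt}}$ is the polynomial of degree at most $4$ whose cell averages match $\overline u_i$ for $i\in\{-2,-1,0,1,2\}$. For a polynomial $q$ of degree at most $d$, $I[q]=\sum_{\beta=1}^{d}\Delta x^{2\beta-1}\int_{\Omega_0}(q^{(\beta)}(x))^2\,dx$. Set $I_0=I[P_{\mathrm{opt}}]$ and $I_k=I[P_k]$ for $k=1,2,3$.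
   Formalization: The order is 6 exactly when t ≠ 0 and 392u''u'''' ≠ 481(u''')² at 0 (t = 0 or affine u gives no order 6); for such u no t gives an order above 6, and for every smooth u all nonzero t give the same order. *)

(* Defs.v *)
(* Stdlib reals with Coquelicot. *)
From Stdlib Require Import Reals ZArith ClassicalEpsilon.
From Coquelicot Require Import Coquelicot.
Open Scope R_scope.

Definition smooth_near_0 (u : R -> R) : Prop :=
  locally 0 (fun x => forall n : nat, ex_derive_n u n x).

(* [has_order g r] is theta(g) = r.  The variable is a mesh size, so the limit
   is taken through positive values.  A function that vanishes identically
   near 0 has no order. *)
Definition has_order (g : R -> R) (r : nat) : Prop :=
  exists a : R, a <> 0 /\
    is_domin (at_right 0) (fun rho => rho ^ r) (fun rho => g rho - a * rho ^ r).

Definition cell_left (h : R) (i : Z) : R := (IZR i - / 2) * h.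
Definition cell_right (h : R) (i : Z) : R := (IZR i + / 2) * h.

Definition cell_average (h : R) (f : R -> R) (i : Z) : R :=
  / h * RInt f (cell_left h i) (cell_right h i).

Definition is_poly (d : nat) (q : R -> R) : Prop :=
  exists c : nat -> R, forall x, q x = sum_f_R0 (fun k => c k * x ^ k) d.

(* [q] has degree at most [d] and the same averages as [u] on the [d + 1]
   consecutive cells [m], ..., [m + d]. *)
Definition reconstructs (d : nat) (m : Z) (u : R -> R) (h : R) (q : R -> R) : Prop :=
  is_poly d q /\
  forall i : Z, (m <= i <= m + Z.of_nat d)%Z ->
    cell_average h q i = cell_average h u i.

(* For [h <> 0] exactly one function satisfies [reconstructs d m u h], and
   [epsilon] selects it. *)
Definition reconstruction (d : nat) (m : Z) (u : R -> R) (h : R) : R -> R :=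
  epsilon (inhabits (fun _ : R => 0)) (reconstructs d m u h).

Definition P1 := reconstruction 2 (-2).
Definition P2 := reconstruction 2 (-1).
Definition P3 := reconstruction 2 0.
Definition Popt := reconstruction 4 (-2).

Definition smoothness (d : nat) (h : R) (q : R -> R) : R :=
  sum_n_m (fun b : nat =>
    h ^ (2 * b - 1) *
    RInt (fun x => (Derive_n q b x) ^ 2) (cell_left h 0) (cell_right h 0)) 1 d.

Definition I1 (u : R -> R) (h : R) : R := smoothness 2 h (P1 u h).
Definition I2 (u : R -> R) (h : R) : R := smoothness 2 h (P2 u h).
Definition I3 (u : R -> R) (h : R) : R := smoothness 2 h (P3 u h).
Definition I0 (u : R -> R) (h : R) : R := smoothness 4 h (Popt u h).

Definition tau5 (u : R -> R) (t h : R) : R :=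
  Rabs (t * I1 u h + 4 * t * I2 u h + t * I3 u h - 6 * t * I0 u h).

(* As [h] tends to 0, the combination inside [tau5 u t h] is
     t / 120 * (392 u''(0) u''''(0) - 481 u'''(0)^2) h^6 + O(h^7),
   so this is the condition on the Taylor coefficients of [u] under which the
   term of order 6 is present for [t <> 0]. *)
Definition generic_at_0 (u : R -> R) : Prop :=
  392 * Derive_n u 2 0 * Derive_n u 4 0 <> 481 * (Derive_n u 3 0) ^ 2.

(* Main.v *)
Require Import Defs.
From Stdlib Require Import Reals ZArith ClassicalEpsilon Lra Lia.
From Coquelicot Require Import Coquelicot.
Open Scope R_scope.

(** Cell averages of a polynomial are linear in its coefficients, and a
    smoothness indicator is a quadratic form in the coefficients scaled by powers
    of [h].  Hence [I1 + 4 I2 + I3 - 6 I0] is, for every [h <> 0], an exact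
    quadratic form in the five averages; it is insensitive to constants, so it is
    a form in the centred differences [diff1], ..., [diff4], where the difference
    of order [k] has size [h ^ k].  Reflection symmetry removes the products of
    an even and an odd difference.  With the weights 1, 4, 1, -6 the terms
    in [diff1 ^ 2], [diff1 * diff3] and [diff2 ^ 2], those of order below 6, also
    cancel, and [indicator_defect_diff] gives
      49/15 diff2 diff4 - 481/120 diff3^2 - 1319/224 diff4^2.

    By Taylor's formula the difference of order [k] divided by [h ^ k] tends to
    the derivative of order [k] of [u] at 0 ([diff2_tends_to] and its analogues),
    so the form divided by [h ^ 6] tends to
    (392 u'' u'''' - 481 u'''^2) / 120 at 0 ([indicator_defect_tends_to]), a
    number that is nonzero exactly when [u] is generic.  Since [tau5 u t] is
    [Rabs t] times the absolute value of this one function of [h], a nonzero [t]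
    only rescales it and cannot change the order, while [t = 0] leaves the zero
    function, which has none. *)

(** * Polynomials *)

Definition poly (c : nat -> R) (d : nat) (x : R) : R :=
  sum_f_R0 (fun k => c k * x ^ k) d.

Definition deriv_coef (c : nat -> R) (k : nat) : R := INR (S k) * c (S k).

Lemma is_derive_poly (c : nat -> R) (d : nat) (x : R) :
  is_derive (poly c (S d)) x (poly (deriv_coef c) d x).
Proof.
  induction d as [|d IH].
  - unfold poly, deriv_coef; simpl; auto_derive; [easy | ring].
  - apply is_derive_ext
      with (fun y => plus (poly c (S d) y) (c (S (S d)) * y ^ S (S d))).
    + intros y; reflexivity.
    + replace (poly (deriv_coef c) (S d) x)
        with (plus (poly (deriv_coef c) d x) (deriv_coef c (S d) * x ^ S d))
        by reflexivity.
      apply (is_derive_plus (V := R_NormedModule)); [exact IH |].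
      unfold deriv_coef; auto_derive; [easy |].
      destruct d; simpl; ring.
Qed.

Lemma Derive_n_poly (b : nat) : forall (c : nat -> R) (d : nat) (x : R),
  Derive_n (poly c (b + d)) b x = poly (Nat.iter b deriv_coef c) d x.
Proof.
  induction b as [|b IH]; intros c d x; [reflexivity |].
  simpl Derive_n.
  rewrite (Derive_ext _ (poly (Nat.iter b deriv_coef c) (S d))).
  - apply is_derive_unique, is_derive_poly.
  - intros y. replace (S (b + d)) with (b + S d)%nat by lia. apply IH.
Qed.

Lemma is_RInt_poly (c : nat -> R) (d : nat) (a b : R) :
  is_RInt (poly c d) a b
    (sum_f_R0 (fun k => c k * ((b ^ S k - a ^ S k) / INR (S k))) d).
Proof.
  assert (mono : forall k, is_RInt (fun x => c k * x ^ k) a b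
                   (c k * ((b ^ S k - a ^ S k) / INR (S k)))).
  { intros k.
    replace (c k * ((b ^ S k - a ^ S k) / INR (S k)))
      with (minus (c k * b ^ S k / INR (S k)) (c k * a ^ S k / INR (S k)))
      by (unfold minus, plus, opp; simpl plus; simpl opp; unfold Rdiv; simpl; ring).
    apply (is_RInt_derive (fun x => c k * x ^ S k / INR (S k))).
    - intros x _. assert (H := not_0_INR (S k) (Nat.neq_succ_0 k)).
      auto_derive; [easy |].
      rewrite S_INR in H. simpl. field.
      destruct k; simpl in *; lra.
    - intros x _. apply (ex_derive_continuous (fun x => c k * x ^ k)).
      auto_derive; easy. }
  induction d as [|d IH]; [apply mono |].
  exact (is_RInt_plus (poly c d) _ a b _ _ IH (mono (S d))).
Qed.

(** * Cell averages and reconstructions *)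

Definition monomial_average (k : nat) (i : Z) : R :=
  ((IZR i + / 2) ^ S k - (IZR i - / 2) ^ S k) / INR (S k).

Lemma cell_average_poly (c : nat -> R) (d : nat) (h : R) (i : Z) :
  h <> 0 ->
  cell_average h (poly c d) i
  = sum_f_R0 (fun k => c k * h ^ k * monomial_average k i) d.
Proof.
  intros hne. unfold cell_average.
  rewrite (is_RInt_unique _ _ _ _ (is_RInt_poly c d _ _)), scal_sum.
  apply sum_eq. intros k _.
  unfold cell_left, cell_right, monomial_average.
  rewrite !Rpow_mult_distr. simpl pow at 2 4.
  assert (H := not_0_INR (S k) (Nat.neq_succ_0 k)).
  field; split; assumption.
Qed.

Lemma cell_average_ext (h : R) (f g : R -> R) (i : Z) :
  (forall x, f x = g x) -> cell_average h f i = cell_average h g i.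
Proof.
  intros H. unfold cell_average. f_equal. apply RInt_ext. intros x _. apply H.
Qed.

(** This replaces the choice hidden in [reconstruction] by the linear system
    between coefficients and averages, which later determines the scaled
    coefficients [c k * h ^ k] and hence the indicators. *)
Lemma reconstruction_coefficients (d : nat) (m : Z) (u : R -> R) (h : R) :
  h <> 0 -> (exists q, reconstructs d m u h q) ->
  exists c, (forall x, reconstruction d m u h x = poly c d x) /\
    forall i : Z, (m <= i <= m + Z.of_nat d)%Z ->
      cell_average h u i
      = sum_f_R0 (fun k => c k * h ^ k * monomial_average k i) d.
Proof.
  intros hne ex.
  destruct (epsilon_spec (inhabits (fun _ : R => 0)) _ ex) as [[c Hc] Havg].
  exists c. split; [exact Hc |]. intros i Hi.
  rewrite <- (Havg i Hi), <- (cell_average_poly c d h i hne).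
  apply cell_average_ext, Hc.
Qed.

(** The quadratic is written in powers of [x / h - (m + 1)], the scaled distance
    to the midpoint of the middle cell; there its coefficients are the
    differences of the averages. *)
Lemma quadratic_reconstruction_exists (m : Z) (u : R -> R) (h : R) :
  h <> 0 -> exists q, reconstructs 2 m u h q.
Proof.
  intros hne.
  set (a0 := cell_average h u m).
  set (a1 := cell_average h u (m + 1)).
  set (a2 := cell_average h u (m + 2)).
  set (b1 := (a2 - a0) / 2). set (b2 := (a2 - 2 * a1 + a0) / 2).
  set (b0 := a1 - b2 / 12). set (z := IZR m + 1).
  set (c := fun k => match k with
     | O => b0 - b1 * z + b2 * z ^ 2
     | 1%nat => (b1 - 2 * b2 * z) / h
     | _ => b2 / h ^ 2 end).
  exists (poly c 2). split; [exists c; reflexivity |].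
  intros i Hi. rewrite cell_average_poly by assumption.
  assert (Hcase : i = m \/ i = (m + 1)%Z \/ i = (m + 2)%Z) by lia.
  destruct Hcase as [-> | [-> | ->]];
    [fold a0 | fold a1 | fold a2];
    unfold c, b0, b1, b2, z, monomial_average; simpl; rewrite ?plus_IZR;
    field; assumption.
Qed.

(** * Finite differences of the averages *)

Definition diff1 (a : Z -> R) : R := (a 1%Z - a (-1)%Z) / 2.
Definition diff2 (a : Z -> R) : R := a 1%Z - 2 * a 0%Z + a (-1)%Z.
Definition diff3 (a : Z -> R) : R :=
  (a 2%Z - 2 * a 1%Z + 2 * a (-1)%Z - a (-2)%Z) / 2.
Definition diff4 (a : Z -> R) : R :=
  a 2%Z - 4 * a 1%Z + 6 * a 0%Z - 4 * a (-1)%Z + a (-2)%Z.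

(** The average of d0 + d1 y + d2 y^2 + d3 y^3 + d4 y^4, with y = x / h, on the
    cell [i] is d0 + d1 i + d2 (i^2 + 1/12) + d3 (i^3 + i/4)
    + d4 (i^4 + i^2/2 + 1/80).  Its differences are diff4 = 24 d4,
    diff3 = 6 d3, diff2 = 2 d2 + 3 d4 and diff1 = d1 + 5/4 d3; the witness is
    the solution of this triangular system. *)
Lemma quartic_reconstruction_exists (u : R -> R) (h : R) :
  h <> 0 -> exists q, reconstructs 4 (-2) u h q.
Proof.
  intros hne. set (a := cell_average h u).
  set (d4 := diff4 a / 24). set (d3 := diff3 a / 6).
  set (d2 := diff2 a / 2 - diff4 a / 16).
  set (d1 := diff1 a - 5 / 24 * diff3 a).
  set (d0 := a 0%Z - d2 / 12 - d4 / 80).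
  set (c := fun k => match k with
     | O => d0
     | 1%nat => d1 / h
     | 2%nat => d2 / h ^ 2
     | 3%nat => d3 / h ^ 3
     | _ => d4 / h ^ 4 end).
  exists (poly c 4). split; [exists c; reflexivity |].
  intros i Hi. rewrite cell_average_poly by assumption.
  fold a.
  assert (Hcase : (i = -2 \/ i = -1 \/ i = 0 \/ i = 1 \/ i = 2)%Z) by lia.
  destruct Hcase as [-> | [-> | [-> | [-> | ->]]]];
    unfold c, d0, d1, d2, d3, d4, diff1, diff2, diff3, diff4, monomial_average;
    simpl; field; assumption.
Qed.

(** * Smoothness indicators *)

(** All four derivatives of a quartic are cubics with trailing zero coefficients,
    so this one integral evaluates every term of every indicator. *)
Lemma RInt_square_cubic (h e0 e1 e2 e3 : R) :
  RInt (fun x => (e0 + e1 * x + e2 * x ^ 2 + e3 * x ^ 3) ^ 2)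
    (cell_left h 0) (cell_right h 0)
  = e0 ^ 2 * h + (e1 ^ 2 + 2 * e0 * e2) * h ^ 3 / 12
    + (e2 ^ 2 + 2 * e1 * e3) * h ^ 5 / 80 + e3 ^ 2 * h ^ 7 / 448.
Proof.
  set (F := fun x => e0 ^ 2 * x + e0 * e1 * x ^ 2
    + (e1 ^ 2 + 2 * e0 * e2) * x ^ 3 / 3 + (e0 * e3 + e1 * e2) * x ^ 4 / 2
    + (e2 ^ 2 + 2 * e1 * e3) * x ^ 5 / 5 + e2 * e3 * x ^ 6 / 3
    + e3 ^ 2 * x ^ 7 / 7).
  rewrite (is_RInt_unique _ _ _ (minus (F (cell_right h 0)) (F (cell_left h 0)))).
  - unfold minus, plus, opp; simpl plus; simpl opp.
    unfold F, cell_left, cell_right; simpl; field.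
  - apply (is_RInt_derive F).
    + intros x _. unfold F. auto_derive; [easy |]. simpl. field.
    + intros x _.
      apply (ex_derive_continuous
               (fun x => (e0 + e1 * x + e2 * x ^ 2 + e3 * x ^ 3) ^ 2)).
      auto_derive; easy.
Qed.

Lemma smoothness_ext (d : nat) (h : R) (p q : R -> R) :
  (forall x, p x = q x) -> smoothness d h p = smoothness d h q.
Proof.
  intros H. unfold smoothness. apply sum_n_m_ext. intros b. f_equal.
  apply RInt_ext. intros x _. f_equal. apply Derive_n_ext, H.
Qed.

(* Replaces the integral of the squared [b]-th derivative of [poly c (b + d)] by
   its value, the derivative being the cubic with coefficients [e0], ..., [e3]. *)
Ltac integrate_square b d e0 e1 e2 e3 :=
  match goal with |- context [RInt (fun x => Derive_n (poly ?c _) b x ^ 2)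
                                (cell_left ?h 0) (cell_right ?h 0)] =>
    let n := eval compute in (b + d)%nat in
    rewrite (RInt_ext (fun x => Derive_n (poly c n) b x ^ 2)
               (fun x => (e0 + e1 * x + e2 * x ^ 2 + e3 * x ^ 3) ^ 2)
               (cell_left h 0) (cell_right h 0));
    [ rewrite (RInt_square_cubic h e0 e1 e2 e3)
    | intros x _;
      change (Derive_n (poly c n) b x) with (Derive_n (poly c (b + d)) b x);
      rewrite (Derive_n_poly b c d x); unfold poly, deriv_coef; simpl; ring ]
  end.

Lemma smoothness_quadratic (h : R) (c : nat -> R) :
  smoothness 2 h (poly c 2)
  = (c 1%nat * h) ^ 2 + 13 / 3 * (c 2%nat * h ^ 2) ^ 2.
Proof.
  unfold smoothness. rewrite sum_n_Sm, sum_n_n by lia.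
  unfold plus; simpl plus.
  integrate_square 1%nat 1%nat (c 1%nat) (2 * c 2%nat) 0 0.
  integrate_square 2%nat 0%nat (2 * c 2%nat) 0 0 0.
  simpl. field.
Qed.

Lemma smoothness_quartic (h : R) (c : nat -> R) :
  let d1 := c 1%nat * h in let d2 := c 2%nat * h ^ 2 in
  let d3 := c 3%nat * h ^ 3 in let d4 := c 4%nat * h ^ 4 in
  smoothness 4 h (poly c 4)
  = d1 ^ 2 + 13 / 3 * d2 ^ 2 + d1 * d3 / 2 + 3129 / 80 * d3 ^ 2
    + 21 / 5 * d2 * d4 + 87617 / 140 * d4 ^ 2.
Proof.
  intros d1 d2 d3 d4. unfold smoothness.
  rewrite 3!sum_n_Sm, sum_n_n by lia.
  unfold plus; simpl plus.
  integrate_square 1%nat 3%nat (c 1%nat) (2 * c 2%nat) (3 * c 3%nat) (4 * c 4%nat).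
  integrate_square 2%nat 2%nat (2 * c 2%nat) (6 * c 3%nat) (12 * c 4%nat) 0.
  integrate_square 3%nat 1%nat (6 * c 3%nat) (24 * c 4%nat) 0 0.
  integrate_square 4%nat 0%nat (24 * c 4%nat) 0 0 0.
  unfold d1, d2, d3, d4. simpl. field.
Qed.

(** * The combination of indicators *)

(** Here [s / 2] is the scaled coefficient of degree 2, and [s * (IZR m + 1)]
    moves the slope from the midpoint of the middle cell [m + 1] to 0. *)
Lemma smoothness_quadratic_reconstruction (m : Z) (u : R -> R) (h : R) :
  h <> 0 ->
  let a := cell_average h u in
  let s := a (m + 2)%Z - 2 * a (m + 1)%Z + a m in
  smoothness 2 h (reconstruction 2 m u h)
  = ((a (m + 2)%Z - a m) / 2 - (IZR m + 1) * s) ^ 2 + 13 / 12 * s ^ 2.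
Proof.
  intros hne a s.
  destruct (reconstruction_coefficients 2 m u h hne
              (quadratic_reconstruction_exists m u h hne)) as (c & Hc & Havg).
  rewrite (smoothness_ext 2 h _ _ Hc), smoothness_quadratic.
  unfold s, a.
  rewrite (Havg m), (Havg (m + 1)%Z), (Havg (m + 2)%Z) by lia.
  unfold monomial_average; simpl; rewrite ?plus_IZR. field.
Qed.

Lemma smoothness_quartic_reconstruction (u : R -> R) (h : R) :
  h <> 0 ->
  let a := cell_average h u in
  let d1 := diff1 a - 5 / 24 * diff3 a in
  let d2 := diff2 a / 2 - diff4 a / 16 in
  let d3 := diff3 a / 6 in
  let d4 := diff4 a / 24 in
  smoothness 4 h (reconstruction 4 (-2) u h)
  = d1 ^ 2 + 13 / 3 * d2 ^ 2 + d1 * d3 / 2 + 3129 / 80 * d3 ^ 2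
    + 21 / 5 * d2 * d4 + 87617 / 140 * d4 ^ 2.
Proof.
  intros hne a d1 d2 d3 d4.
  destruct (reconstruction_coefficients 4 (-2) u h hne
              (quartic_reconstruction_exists u h hne)) as (c & Hc & Havg).
  rewrite (smoothness_ext 4 h _ _ Hc), smoothness_quartic; cbv zeta.
  assert (H1 : d1 = c 1%nat * h).
  { unfold d1, a, diff1, diff3. rewrite !Havg by lia.
    unfold monomial_average; simpl. field. }
  assert (H2 : d2 = c 2%nat * h ^ 2).
  { unfold d2, a, diff2, diff4. rewrite !Havg by lia.
    unfold monomial_average; simpl. field. }
  assert (H3 : d3 = c 3%nat * h ^ 3).
  { unfold d3, a, diff3. rewrite !Havg by lia.
    unfold monomial_average; simpl. field. }
  assert (H4 : d4 = c 4%nat * h ^ 4).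
  { unfold d4, a, diff4. rewrite !Havg by lia.
    unfold monomial_average; simpl. field. }
  rewrite H1, H2, H3, H4. reflexivity.
Qed.

Definition indicator_defect (u : R -> R) (h : R) : R :=
  I1 u h + 4 * I2 u h + I3 u h - 6 * I0 u h.

(** This cancellation raises the order to 6: the contributions of
    [diff1] and of [diff2 ^ 2] to the three quadratics, with weights 1, 4, 1, are
    exactly six times their contributions to the quartic. *)
Lemma indicator_defect_diff (u : R -> R) (h : R) :
  h <> 0 ->
  let a := cell_average h u in
  indicator_defect u h
  = 49 / 15 * diff2 a * diff4 a - 481 / 120 * diff3 a ^ 2
    - 1319 / 224 * diff4 a ^ 2.
Proof.
  intros hne a. unfold indicator_defect, I1, I2, I3, I0, P1, P2, P3, Popt.
  rewrite !smoothness_quadratic_reconstruction,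
    smoothness_quartic_reconstruction by assumption.
  cbv zeta. fold a. simpl Z.add.
  unfold diff1, diff2, diff3, diff4. field.
Qed.

Lemma tau5_defect (u : R -> R) (t h : R) :
  tau5 u t h = Rabs t * Rabs (indicator_defect u h).
Proof.
  rewrite <- Rabs_mult. unfold tau5, indicator_defect. f_equal. ring.
Qed.

(** * Limits as the mesh size decreases to zero *)

Definition tends_to (g : R -> R) (l : R) : Prop :=
  filterlim g (at_right 0) (locally l).

Lemma tends_to_plus (f g : R -> R) (l m : R) :
  tends_to f l -> tends_to g m -> tends_to (fun h => f h + g h) (l + m).
Proof.
  intros Hf Hg.
  exact (filterlim_comp_2 f g Rplus Hf Hg (filterlim_plus (V := R_NormedModule) l m)).
Qed.

Lemma tends_to_mult (f g : R -> R) (l m : R) :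
  tends_to f l -> tends_to g m -> tends_to (fun h => f h * g h) (l * m).
Proof.
  intros Hf Hg.
  exact (filterlim_comp_2 f g Rmult Hf Hg (filterlim_mult (K := R_AbsRing) l m)).
Qed.

Lemma tends_to_const (a : R) : tends_to (fun _ => a) a.
Proof. apply filterlim_const. Qed.

Lemma tends_to_id : tends_to (fun h => h) 0.
Proof. intros P HP. apply filter_le_within, HP. Qed.

Lemma tends_to_pow_0 (n : nat) : tends_to (fun h => h ^ S n) 0.
Proof.
  induction n as [|n IH].
  - apply (filterlim_ext (fun h => h)); [intros h; simpl; ring | apply tends_to_id].
  - replace 0 with (0 * 0) by ring. exact (tends_to_mult _ _ _ _ tends_to_id IH).
Qed.

Lemma tends_to_Rabs (f : R -> R) (l : R) :
  tends_to f l -> tends_to (fun h => Rabs (f h)) (Rabs l).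
Proof.
  intros Hf. apply (filterlim_comp _ _ _ f Rabs _ _ _ Hf), continuous_Rabs.
Qed.

Lemma tends_to_ext (f g : R -> R) (l : R) :
  (forall h, 0 < h -> f h = g h) -> tends_to f l -> tends_to g l.
Proof. apply filterlim_within_ext. Qed.

Lemma tends_to_unique (f : R -> R) (l m : R) :
  tends_to f l -> tends_to f m -> l = m.
Proof.
  exact (filterlim_locally_unique (V := R_NormedModule) f l m).
Qed.

Lemma is_domin_iff_tends_to (g : R -> R) (a : R) (r : nat) :
  is_domin (at_right 0) (fun h => h ^ r) (fun h => g h - a * h ^ r)
  <-> tends_to (fun h => g h / h ^ r) a.
Proof.
  unfold tends_to. rewrite filterlim_locally.
  assert (key : forall h, 0 < h ->
    g h - a * h ^ r = (g h / h ^ r - a) * h ^ r /\ 0 < h ^ r).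
  { intros h hpos. assert (H := pow_lt h r hpos). split; [field; lra | exact H]. }
  split; intros H eps.
  (* [is_domin] gives a weak inequality and a ball a strict one. *)
  - specialize (H (pos_div_2 eps)). unfold at_right, within in *.
    revert H; apply filter_imp; intros h H hpos; specialize (H hpos).
    destruct (key h hpos) as [E P].
    change (Rabs (g h - a * h ^ r) <= eps / 2 * Rabs (h ^ r)) in H.
    change (Rabs (g h / h ^ r - a) < eps).
    rewrite E, Rabs_mult in H.
    apply Rmult_le_reg_r in H; [| now apply Rabs_pos_lt, Rgt_not_eq].
    assert (He := cond_pos eps). lra.
  - specialize (H eps). unfold at_right, within in *.
    revert H; apply filter_imp; intros h H hpos; specialize (H hpos).
    destruct (key h hpos) as [E P].
    change (Rabs (g h / h ^ r - a) < eps) in H.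
    change (Rabs (g h - a * h ^ r) <= eps * Rabs (h ^ r)).
    rewrite E, Rabs_mult. apply Rmult_le_compat_r; [apply Rabs_pos | lra].
Qed.

(** * Taylor expansion of the averages *)

Definition taylor_coef (u : R -> R) (k : nat) : R :=
  Derive_n u k 0 / INR (fact k).

(** In the Lagrange remainder of order [S n] the derivative is taken at an
    intermediate point; its continuity at 0 lets the value at 0 replace it, which
    turns the remainder into the last Taylor term plus a small multiple of
    [x ^ S n]. *)
Lemma taylor_remainder_right (u : R -> R) (n : nat) (eps : posreal) :
  smooth_near_0 u ->
  at_right 0 (fun x => Rabs (u x - poly (taylor_coef u) (S n) x) <= eps * x ^ S n).
Proof.
  intros Hs.
  assert (Hcont : continuous (Derive_n u (S n)) 0).
  { apply (ex_derive_continuous (Derive_n u (S n))).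
    exact (locally_singleton _ _ Hs (S (S n))). }
  assert (Hc : locally 0 (fun x => Rabs (Derive_n u (S n) x - Derive_n u (S n) 0) < eps)).
  { exact (proj1 (filterlim_locally (Derive_n u (S n)) _) Hcont eps). }
  destruct Hs as [d1 Hs]. destruct Hc as [d2 Hc].
  assert (Hd : 0 < Rmin d1 d2) by (apply Rmin_pos; apply cond_pos).
  exists (mkposreal _ Hd). intros x Hx hpos.
  change (Rabs (x - 0) < Rmin d1 d2) in Hx.
  rewrite Rminus_0_r, Rabs_pos_eq in Hx by lra.
  assert (Hx1 := Rlt_le_trans _ _ _ Hx (Rmin_l _ _)).
  assert (Hx2 := Rlt_le_trans _ _ _ Hx (Rmin_r _ _)).
  destruct (Taylor_Lagrange u n 0 x hpos) as (z & Hz & E).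
  { intros y Hy k _. apply Hs. change (Rabs (y - 0) < d1).
    rewrite Rminus_0_r, Rabs_pos_eq; lra. }
  assert (Hdz : Rabs (Derive_n u (S n) z - Derive_n u (S n) 0) < eps).
  { apply Hc. change (Rabs (z - 0) < d2). rewrite Rminus_0_r, Rabs_pos_eq; lra. }
  assert (Hf := INR_fact_lt_0 (S n)).
  assert (Hf1 : 1 <= INR (fact (S n))).
  { apply (le_INR 1), lt_O_fact. }
  assert (Hp := pow_lt x (S n) hpos).
  replace (u x - poly (taylor_coef u) (S n) x)
    with ((Derive_n u (S n) z - Derive_n u (S n) 0) / INR (fact (S n)) * x ^ S n).
  - rewrite Rabs_mult, (Rabs_pos_eq (x ^ S n)) by lra.
    apply Rmult_le_compat_r; [lra |].
    unfold Rdiv. rewrite Rabs_mult, (Rabs_pos_eq (/ _))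
      by (apply Rlt_le, Rinv_0_lt_compat, Hf).
    apply (Rle_trans _ (Rabs (Derive_n u (S n) z - Derive_n u (S n) 0) * 1)); [| lra].
    apply Rmult_le_compat_l; [apply Rabs_pos |].
    rewrite <- Rinv_1. apply Rinv_le_contravar; lra.
  - rewrite E. unfold poly. cbn [sum_f_R0].
    rewrite (sum_eq _ (fun k => taylor_coef u k * x ^ k)).
    + unfold taylor_coef at 3. rewrite Rminus_0_r. field. lra.
    + intros k _. unfold taylor_coef. rewrite Rminus_0_r. field. apply INR_fact_neq_0.
Qed.

Lemma locally_opp_0 (P : R -> Prop) : locally 0 P -> locally 0 (fun x => P (- x)).
Proof.
  intros [d H]. exists d. intros x Hx. apply H.
  change (Rabs (x - 0) < d) in Hx. change (Rabs (- x - 0) < d).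
  rewrite Rminus_0_r in *. rewrite Rabs_Ropp. exact Hx.
Qed.

(** Negative points are reached by applying the expansion to [x => u (- x)]. *)
Lemma taylor_remainder (u : R -> R) (n : nat) (eps : posreal) :
  smooth_near_0 u ->
  locally 0 (fun x => Rabs (u x - poly (taylor_coef u) (S n) x) <= eps * Rabs x ^ S n).
Proof.
  intros Hs.
  set (v := fun x => u (- x)).
  assert (Hv : smooth_near_0 v).
  { unfold smooth_near_0.
    generalize (locally_locally _ _
      (locally_opp_0 (fun x => forall n', ex_derive_n u n' x) Hs)).
    apply filter_imp; intros x Hx n'.
    apply ex_derive_n_comp_opp.
    assert (H : filterlim Ropp (locally (- x)) (locally x)).
    { rewrite <- (Ropp_involutive x) at 2.
      apply (filterlim_opp (V := R_NormedModule) (- x)). }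
    specialize (H _ Hx). revert H. unfold filtermap; apply filter_imp.
    intros y Hy k _. rewrite <- (Ropp_involutive y). apply Hy. }
  assert (Hcoef : forall k, taylor_coef v k = (-1) ^ k * taylor_coef u k).
  { intros k. unfold taylor_coef, v. rewrite Derive_n_comp_opp, Ropp_0.
    - field. apply INR_fact_neq_0.
    - rewrite Ropp_0. unfold smooth_near_0 in Hs. revert Hs; apply filter_imp.
      intros y Hy j _. apply Hy. }
  assert (Hl := locally_opp_0 _ (taylor_remainder_right v n eps Hv)).
  assert (Hr := taylor_remainder_right u n eps Hs).
  generalize (filter_and _ _ Hl Hr). apply filter_imp. clear Hl Hr.
  intros x [Hl Hr]. destruct (Rtotal_order x 0) as [Hx | [-> | Hx]].
  - rewrite (Rabs_left x Hx).
    replace (u x - poly (taylor_coef u) (S n) x)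
      with (v (- x) - poly (taylor_coef v) (S n) (- x)); [apply Hl; lra |].
    unfold v. rewrite Ropp_involutive. f_equal. apply sum_eq. intros k _.
    rewrite Hcoef.
    replace (x ^ k) with ((-1) ^ k * (- x) ^ k); [ring |].
    rewrite <- Rpow_mult_distr. f_equal. ring.
  - replace (poly (taylor_coef u) (S n) 0) with (u 0).
    + rewrite Rminus_diag, Rabs_R0. simpl. lra.
    + unfold poly. rewrite decomp_sum by lia. rewrite sum_eq_R0.
      * unfold taylor_coef; simpl. field.
      * intros k _. simpl. ring.
  - rewrite (Rabs_pos_eq x) by lra. apply Hr, Hx.
Qed.

Definition average_remainder (u : R -> R) (n : nat) (i : Z) (h : R) : R :=
  (cell_average h u i
   - sum_f_R0 (fun k => taylor_coef u k * h ^ k * monomial_average k i) n) / h ^ n.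

Lemma average_remainder_tends_to (u : R -> R) (n : nat) (i : Z) :
  smooth_near_0 u -> tends_to (average_remainder u (S n) i) 0.
Proof.
  intros Hs. unfold tends_to. rewrite filterlim_locally. intros eps.
  (* The cell [i] is contained in the ball of radius [M * h] around 0. *)
  set (M := Rabs (IZR i) + 1).
  assert (HM : 1 <= M) by (unfold M; assert (H := Rabs_pos (IZR i)); lra).
  assert (HMn : 0 < M ^ S n) by (apply pow_lt; lra).
  assert (He : 0 < eps / (2 * M ^ S n)).
  { apply Rdiv_lt_0_compat; [apply cond_pos | lra]. }
  assert (Ht := taylor_remainder u n (mkposreal _ He) Hs). cbn [pos] in Ht.
  generalize (filter_and _ _ Hs Ht). intros [d Hd].
  assert (HdM : 0 < d / M) by (apply Rdiv_lt_0_compat; [apply cond_pos | lra]).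
  exists (mkposreal _ HdM). intros h Hh hpos.
  change (Rabs (h - 0) < d / M) in Hh.
  rewrite Rminus_0_r, Rabs_pos_eq in Hh by lra.
  assert (HhM : M * h < d).
  { apply (Rmult_lt_compat_l M) in Hh; [| lra].
    replace (M * (d / M)) with (pos d) in Hh by (field; lra). exact Hh. }
  assert (Hlr : cell_left h i <= cell_right h i) by (unfold cell_left, cell_right; nra).
  assert (Hcell : forall x, cell_left h i <= x <= cell_right h i -> Rabs x <= M * h).
  { intros x Hx. unfold cell_left, cell_right in Hx. unfold M.
    assert (H1 := Rle_abs (IZR i)). assert (H2 := Rabs_maj2 (IZR i)).
    apply Rabs_le. nra. }
  assert (Hball : forall x, cell_left h i <= x <= cell_right h i -> ball 0 d x).
  { intros x Hx. change (Rabs (x - 0) < d). rewrite Rminus_0_r.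
    specialize (Hcell x Hx). lra. }
  set (T := poly (taylor_coef u) (S n)).
  assert (Hu : ex_RInt u (cell_left h i) (cell_right h i)).
  { apply (ex_RInt_continuous (V := R_CompleteNormedModule)). intros x Hx.
    rewrite Rmin_left, Rmax_right in Hx by exact Hlr.
    apply (ex_derive_continuous (V := R_NormedModule) u x).
    exact (proj1 (Hd x (Hball x Hx)) 1%nat). }
  assert (HT : ex_RInt T (cell_left h i) (cell_right h i)).
  { eexists. apply is_RInt_poly. }
  assert (Hint : Rabs (RInt u (cell_left h i) (cell_right h i)
                       - RInt T (cell_left h i) (cell_right h i))
                 <= (cell_right h i - cell_left h i)
                    * (eps / (2 * M ^ S n) * (M * h) ^ S n)).
  { change (RInt u (cell_left h i) (cell_right h i)
            - RInt T (cell_left h i) (cell_right h i))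
      with (minus (RInt u (cell_left h i) (cell_right h i))
                  (RInt T (cell_left h i) (cell_right h i))).
    rewrite <- (RInt_minus (V := R_CompleteNormedModule) u T _ _ Hu HT).
    apply abs_RInt_le_const;
      [exact Hlr | now apply (ex_RInt_minus (V := R_NormedModule)) |].
    intros x Hx. apply (Rle_trans _ _ _ (proj2 (Hd x (Hball x Hx)))).
    apply Rmult_le_compat_l; [lra |].
    apply pow_incr. split; [apply Rabs_pos | exact (Hcell x Hx)]. }
  assert (Hn := pow_lt h (S n) hpos).
  change (Rabs (average_remainder u (S n) i h - 0) < eps).
  rewrite Rminus_0_r. unfold average_remainder.
  rewrite <- cell_average_poly by lra. fold T. unfold cell_average.
  set (p := RInt u _ _) in *. set (q := RInt T _ _) in *.
  replace ((/ h * p - / h * q) / h ^ S n) with ((p - q) * / (h * h ^ S n))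
    by (field; lra).
  rewrite Rabs_mult, (Rabs_pos_eq (/ _)) by (apply Rlt_le, Rinv_0_lt_compat; nra).
  apply Rle_lt_trans with (eps / 2); [| assert (H := cond_pos eps); lra].
  replace (eps / 2) with
    ((cell_right h i - cell_left h i) * (eps / (2 * M ^ S n) * (M * h) ^ S n)
     * / (h * h ^ S n)).
  - apply Rmult_le_compat_r; [apply Rlt_le, Rinv_0_lt_compat; nra | exact Hint].
  (* The cell has length [h], so the bound is exactly half of [eps]. *)
  - rewrite Rpow_mult_distr. unfold cell_left, cell_right. field. lra.
Qed.

(** The difference of order [k] sends the averages of 1, x, ..., x^(k-1) to 0 and
    those of x^k to k! h^k, so the Taylor polynomial of degree [k] contributes
    exactly the derivative of order [k]. *)
Lemma diff2_tends_to (u : R -> R) :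
  smooth_near_0 u ->
  tends_to (fun h => diff2 (cell_average h u) / h ^ 2) (Derive_n u 2 0).
Proof.
  intros Hs. assert (Hr := fun i => average_remainder_tends_to u 1 i Hs).
  apply (tends_to_ext (fun h => Derive_n u 2 0
    + (average_remainder u 2 1 h + -2 * average_remainder u 2 0 h
       + average_remainder u 2 (-1) h))).
  - intros h hpos. unfold diff2, average_remainder, monomial_average, taylor_coef.
    simpl. field. lra.
  - replace (Derive_n u 2 0) with (Derive_n u 2 0 + (0 + -2 * 0 + 0)) at 1 by ring.
    repeat first [apply tends_to_plus | apply tends_to_mult | apply tends_to_const
                 | apply Hr].
Qed.

Lemma diff3_tends_to (u : R -> R) :
  smooth_near_0 u ->
  tends_to (fun h => diff3 (cell_average h u) / h ^ 3) (Derive_n u 3 0).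
Proof.
  intros Hs. assert (Hr := fun i => average_remainder_tends_to u 2 i Hs).
  apply (tends_to_ext (fun h => Derive_n u 3 0
    + (/ 2 * average_remainder u 3 2 h + -1 * average_remainder u 3 1 h
       + 1 * average_remainder u 3 (-1) h + - / 2 * average_remainder u 3 (-2) h))).
  - intros h hpos. unfold diff3, average_remainder, monomial_average, taylor_coef.
    simpl. field. lra.
  - replace (Derive_n u 3 0)
      with (Derive_n u 3 0 + (/ 2 * 0 + -1 * 0 + 1 * 0 + - / 2 * 0)) at 1 by ring.
    repeat first [apply tends_to_plus | apply tends_to_mult | apply tends_to_const
                 | apply Hr].
Qed.

Lemma diff4_tends_to (u : R -> R) :
  smooth_near_0 u ->
  tends_to (fun h => diff4 (cell_average h u) / h ^ 4) (Derive_n u 4 0).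
Proof.
  intros Hs. assert (Hr := fun i => average_remainder_tends_to u 3 i Hs).
  apply (tends_to_ext (fun h => Derive_n u 4 0
    + (average_remainder u 4 2 h + -4 * average_remainder u 4 1 h
       + 6 * average_remainder u 4 0 h + -4 * average_remainder u 4 (-1) h
       + average_remainder u 4 (-2) h))).
  - intros h hpos. unfold diff4, average_remainder, monomial_average, taylor_coef.
    simpl. field. lra.
  - replace (Derive_n u 4 0)
      with (Derive_n u 4 0 + (0 + -4 * 0 + 6 * 0 + -4 * 0 + 0)) at 1 by ring.
    repeat first [apply tends_to_plus | apply tends_to_mult | apply tends_to_const
                 | apply Hr].
Qed.

(** * The order of the global indicator *)

Definition leading_coef (u : R -> R) : R :=
  49 / 15 * (Derive_n u 2 0 * Derive_n u 4 0) + - (481 / 120) * Derive_n u 3 0 ^ 2.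

Lemma leading_coef_neq_0 (u : R -> R) : leading_coef u <> 0 <-> generic_at_0 u.
Proof.
  unfold leading_coef, generic_at_0. split; intros H E; apply H; lra.
Qed.

Lemma indicator_defect_tends_to (u : R -> R) :
  smooth_near_0 u ->
  tends_to (fun h => indicator_defect u h / h ^ 6) (leading_coef u).
Proof.
  intros Hs.
  assert (H2 := diff2_tends_to u Hs).
  assert (H3 := diff3_tends_to u Hs).
  assert (H4 := diff4_tends_to u Hs).
  assert (H33 := tends_to_mult _ _ _ _ H3 H3).
  assert (H24 := tends_to_mult _ _ _ _ H2 H4).
  assert (H44 := tends_to_mult _ _ _ _ (tends_to_pow_0 1) (tends_to_mult _ _ _ _ H4 H4)).
  assert (H := tends_to_plus _ _ _ _
    (tends_to_plus _ _ _ _ (tends_to_mult _ _ _ _ (tends_to_const (49 / 15)) H24)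
                           (tends_to_mult _ _ _ _ (tends_to_const (- (481 / 120))) H33))
    (tends_to_mult _ _ _ _ (tends_to_const (- (1319 / 224))) H44)).
  cbv beta in H.
  replace (leading_coef u) with
    (49 / 15 * (Derive_n u 2 0 * Derive_n u 4 0)
     + - (481 / 120) * (Derive_n u 3 0 * Derive_n u 3 0)
     + - (1319 / 224) * (0 * (Derive_n u 4 0 * Derive_n u 4 0)))
    by (unfold leading_coef; ring).
  revert H. apply tends_to_ext. intros h hpos.
  rewrite indicator_defect_diff by lra. cbv zeta. field. lra.
Qed.

Lemma tau5_tends_to (u : R -> R) (t : R) :
  smooth_near_0 u ->
  tends_to (fun h => tau5 u t h / h ^ 6) (Rabs t * Rabs (leading_coef u)).
Proof.
  intros Hs.
  apply (tends_to_ext (fun h => Rabs t * Rabs (indicator_defect u h / h ^ 6))).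
  - intros h hpos. rewrite tau5_defect. unfold Rdiv.
    rewrite Rabs_mult, (Rabs_pos_eq (/ _)); [ring |].
    apply Rlt_le, Rinv_0_lt_compat, pow_lt, hpos.
  - apply tends_to_mult; [apply tends_to_const |].
    apply tends_to_Rabs, indicator_defect_tends_to, Hs.
Qed.

Lemma has_order_iff (g : R -> R) (r : nat) :
  has_order g r <-> exists a, a <> 0 /\ tends_to (fun h => g h / h ^ r) a.
Proof.
  unfold has_order. split; intros (a & Ha & H); exists a; split; try exact Ha;
    now apply is_domin_iff_tends_to.
Qed.

(** A finite nonzero limit of [g h / h ^ n] excludes a larger order [r], for then
    g h / h^n = (g h / h^r) h^(r-n) would tend to 0. *)
Lemma has_order_maximal (g : R -> R) (a : R) (n r : nat) :
  a <> 0 -> tends_to (fun h => g h / h ^ n) a -> has_order g r -> (r <= n)%nat.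
Proof.
  intros Ha Hg Hr. apply has_order_iff in Hr. destruct Hr as (b & _ & Hb).
  destruct (Nat.le_gt_cases r n) as [H | H]; [exact H | exfalso].
  apply Ha, (tends_to_unique _ _ _ Hg).
  replace 0 with (b * 0) by ring.
  generalize (tends_to_mult _ _ _ _ Hb (tends_to_pow_0 (r - n - 1))).
  apply tends_to_ext. intros h hpos.
  assert (E : h ^ r = h ^ n * h ^ S (r - n - 1)) by (rewrite <- pow_add; f_equal; lia).
  rewrite E. field. split; apply Rgt_not_eq, pow_lt, hpos.
Qed.

Lemma has_order_tau5_neq_0 (u : R -> R) (t : R) (r : nat) :
  has_order (tau5 u t) r -> t <> 0.
Proof.
  intros H ->. apply has_order_iff in H. destruct H as (a & Ha & H).
  apply Ha, (tends_to_unique _ _ _ H).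
  generalize (tends_to_const 0). apply tends_to_ext.
  intros h _. rewrite tau5_defect, Rabs_R0. unfold Rdiv. ring.
Qed.

Lemma has_order_scal (f g : R -> R) (k : R) (r : nat) :
  k <> 0 -> (forall h, g h = k * f h) -> has_order f r -> has_order g r.
Proof.
  rewrite !has_order_iff. intros Hk E (a & Ha & H).
  exists (k * a). split; [now apply Rmult_integral_contrapositive |].
  generalize (tends_to_mult _ _ _ _ (tends_to_const k) H). apply tends_to_ext.
  intros h _. rewrite E. unfold Rdiv. ring.
Qed.

Theorem mainTheorem8 :
  forall u : R -> R, smooth_near_0 u ->
    (forall t : R, exists a : R,
       is_domin (at_right 0) (fun h => h ^ 6) (fun h => tau5 u t h - a * h ^ 6)) /\
    (forall t : R, has_order (tau5 u t) 6 <-> t <> 0 /\ generic_at_0 u) /\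
    (generic_at_0 u ->
       forall (t : R) (r : nat), has_order (tau5 u t) r -> (r <= 6)%nat) /\
    (forall (s t : R) (r : nat),
       s <> 0 -> has_order (tau5 u t) r -> has_order (tau5 u s) r).
Proof.
  intros u Hs. assert (Hlim := fun t => tau5_tends_to u t Hs).
  assert (Hneq : forall t, t <> 0 -> generic_at_0 u ->
                 Rabs t * Rabs (leading_coef u) <> 0).
  { intros t Ht Hg. apply leading_coef_neq_0 in Hg.
    apply Rmult_integral_contrapositive; split; now apply Rabs_no_R0. }
  repeat split.
  - intros t. exists (Rabs t * Rabs (leading_coef u)).
    apply is_domin_iff_tends_to, Hlim.
  - exact (has_order_tau5_neq_0 u t 6 H).
  - apply leading_coef_neq_0. intros E.
    apply has_order_iff in H. destruct H as (a & Ha & H).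
    apply Ha. rewrite (tends_to_unique _ _ _ H (Hlim t)), E, Rabs_R0. ring.
  - intros [Ht Hg]. apply has_order_iff.
    exists (Rabs t * Rabs (leading_coef u)). split; [now apply Hneq | apply Hlim].
  - intros Hg t r H.
    exact (has_order_maximal _ _ 6 r
             (Hneq t (has_order_tau5_neq_0 u t r H) Hg) (Hlim t) H).
  - intros s t r Hs0 H. assert (Ht := has_order_tau5_neq_0 u t r H).
    apply (has_order_scal (tau5 u t) _ (Rabs s / Rabs t)); [| | exact H].
    + apply Rmult_integral_contrapositive; split;
        [| apply Rinv_neq_0_compat]; now apply Rabs_no_R0.
    + intros h. rewrite !tau5_defect. field. now apply Rabs_no_R0.
Qed.
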